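(* Let $F,B$ be as in the context with $\operatorname{Sol}(F,B)\neq\emptyset$, and suppose that $F$ is globally Lipschitz continuous with constant $L$. Then the MAEG-R algorithm described in the context restarts only a finite number of times. Consequently the complexity results of the MAEG method still hold: if the algorithm does not stop at its termination check and $R$ denotes the index of its last epoch, then for any $x_\star\in\operatorname{Sol}(F,B)$ and all $k\ge1$, $$\|\mathcal{R}^c_{\mathrm{nat}}(y_{R,k})\|\ \le\ \|d_{R,k}\|\ \le\ \frac{2\|u_{R,k}-x_\star\|}{(1-2\rho)\Lambda_{R,k}}\ \le\ \frac{2\|u_{R,0}-x_\star\|}{(1-2\rho)\Lambda_{R,k}},$$ and both $\|d_{R,k}\|$ and $\|\mathcal{R}^c_{\mathrm{nat}}(y_{R,k})\|$ are $\mathcal{O}(1/k)$ and moreover $o(1/k)$ as $k\to+\infty$.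
   Context: Problem: $F:\operatorname{dom}F\subseteq\mathbb{R}^n\to\mathbb{R}^n$ is a monotone, continuous (single-valued) operator and $B:\mathbb{R}^n\rightrightarrows\mathbb{R}^n$ is a set-valued maximal monotone operator with $\operatorname{cl}(\operatorname{dom}B)\subseteq\operatorname{dom}F$. $\operatorname{Sol}(F,B)=\{x: 0\in F(x)+B(x)\}$. $\Pi_C$ is the Euclidean projection onto a nonempty closed convex set $C$, and $J_{T}=(\operatorname{Id}+T)^{-1}$ is the resolvent. The composite natural residual is $\mathcal{R}^c_{\mathrm{nat}}(x)=x-J_B(x-F(x))$. MAEG-R algorithm. Input: $x_0\in\operatorname{cl}(\operatorname{dom}B)$; a nonempty closed convex set $X$ with $\operatorname{cl}(\operatorname{dom}B)\subseteq X\subseteq\operatorname{dom}F$; a positive sequence $\{\varepsilon_r\}$ with $\varepsilon_r\to0$; constants $0<\underline{\alpha}_1\le\overline{\alpha}_1$; parameters $\rho\in(0,\frac12)$, $\beta,\sigma,m\in(0,1)$, $\kappa\in[0,2]$, $M>1$. Here $r$ counts epochs (it increases by one at each restart) and $k$ counts iterations inside an epoch. Initialization: $u_{1,0}=x_{1,0}=y_{1,0}=x_0$, $d_{1,0}=0$; $\Lambda_{r,0}=0$ and $(\underline{\lambda}_r,\overline{\lambda}_r)=(0,+\infty)$ for all $r$; $r=k=1$. Step 1 (termination check): if $\|y_{r,k-1}-J_B(y_{r,k-1}-F(y_{r,k-1}))\|=0$, terminate. Step 2 (MAEG step): choose a trial stepsize $\alpha_{r,k}>0$, with $\underline{\alpha}_1\le\alpha_{r,1}\le\overline{\alpha}_1$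 if $k=1$, and $\alpha_{r,k}\ge\lambda_{r,k-1}$ if $k\ge2$. Set $\lambda_{r,k}=\min\{\alpha_{r,k},\overline{\lambda}_r\}\beta^j$, where $j$ is the smallest non-negative integer such that $$\lambda_{r,k}<\underline{\lambda}_r\quad\text{or}\quad\lambda_{r,k}\|F(x_{r,k})-F(y_{r,k})\|\le\sigma\|x_{r,k}-y_{r,k}\|,$$ the (trial) points being, with $\tau_{r,k}=\frac{\lambda_{r,k}}{(1-2\rho)\Lambda_{r,k-1}+\lambda_{r,k}}$, $$x_{r,k}=\Pi_X\bigl(\tau_{r,k}u_{r,k-1}+(1-\tau_{r,k})(y_{r,k-1}-\lambda_{r,k}d_{r,k-1})\bigr),$$ $$y_{r,k}=J_{\lambda_{r,k}B}\bigl(\tau_{r,k}u_{r,k-1}+(1-\tau_{r,k})y_{r,k-1}-\lambda_{r,k}F(x_{r,k})\bigr).$$ With this $\lambda_{r,k}$ and $\tau_{r,k}=\frac{\lambda_{r,k}}{(1-2\rho)\Lambda_{r,k-1}+\lambda_{r,k}}$ compute $x_{r,k}=\Pi_X\bigl(\tau_{r,k}u_{r,k-1}+(1-\tau_{r,k})(y_{r,k-1}-\lambda_{r,k}d_{r,k-1})\bigr)$, $y_{r,k}=J_{\lambda_{r,k}B}\bigl(\tau_{r,k}u_{r,k-1}+(1-\tau_{r,k})y_{r,k-1}-\lambda_{r,k}F(x_{r,k})\bigr)$, and $\Lambda_{r,k}=\Lambda_{r,k-1}+\lambda_{r,k}$, $$d_{r,k}=\tfrac{1}{\lambda_{r,k}}\bigl(\tau_{r,k}u_{r,k-1}+(1-\tau_{r,k})y_{r,k-1}-y_{r,k}\bigr)-F(x_{r,k})+F(y_{r,k}),\qquad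 u_{r,k}=u_{r,k-1}-\rho\lambda_{r,k}d_{r,k}.$$ Step 3 (stepsize bounds): if $k=1$, set $(\underline{\lambda}_r,\overline{\lambda}_r)=(\min\{m\lambda_{r,1},\varepsilon_r\},\,M\lambda_{r,1})$. Step 4 (restart check): if $\lambda_{r,k}<\underline{\lambda}_r$, reject the iterate $(x_{r,k},y_{r,k},d_{r,k},u_{r,k})$ just obtained (it is not part of the output sequence) and set $$u_{r+1,0}=\Pi_{\operatorname{cl}(\operatorname{dom}B)}\Bigl(u_{r,k-1}-\kappa\frac{\langle u_{r,k-1}-y_{r,k-1},d_{r,k-1}\rangle}{\|d_{r,k-1}\|^2}d_{r,k-1}\Bigr),$$ $x_{r+1,0}=y_{r+1,0}=u_{r+1,0}$, $d_{r+1,0}=0$, replace $(r,k)$ by $(r+1,1)$ and return to Step 1 (this is a restart). Step 5: otherwise replace $k$ by $k+1$ and return to Step 1. *)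

(* Defs.v *)
From HB Require Import structures.
From mathcomp Require Import all_boot all_order all_algebra.
From mathcomp Require Import all_classical all_reals all_analysis.

Set Implicit Arguments.
Unset Strict Implicit.
Unset Printing Implicit Defensive.

Import Order.TTheory GRing.Theory Num.Theory.
Import numFieldNormedType.Exports.

Local Open Scope classical_set_scope.
Local Open Scope ring_scope.

(* The library norm on 'rV[R]_n is the sup norm; it induces the same topology
   (used for [closure], [closed], continuity), but all metric notions below
   are Euclidean. *)
Definition dot (R : realType) (n : nat) (x y : 'rV[R]_n) : R :=
  \sum_(i < n) x 0 i * y 0 i.

Definition enorm (R : realType) (n : nat) (x : 'rV[R]_n) : R :=
  Num.sqrt (dot x x).

(* A map F : domF -> R^n is a total function constrained only on domF; a
   set-valued operator T is given by its values T x. *)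
Section Operators.
Variables (R : realType) (n : nat).
Implicit Types (T B : 'rV[R]_n -> set 'rV[R]_n) (F : 'rV[R]_n -> 'rV[R]_n).
Implicit Types (C D : set 'rV[R]_n).

Definition op_dom T : set 'rV[R]_n := [set x | T x !=set0].

Definition monotone_op T : Prop :=
  forall x y a b, T x a -> T y b -> 0 <= dot (a - b) (x - y).

Definition maximal_monotone_op T : Prop :=
  monotone_op T /\
  forall T', monotone_op T' -> (forall x, T x `<=` T' x) -> T' = T.

Definition monotone_on D F : Prop :=
  forall x y, D x -> D y -> 0 <= dot (F x - F y) (x - y).

Definition elipschitz_on D F (L : R) : Prop :=
  forall x y, D x -> D y -> enorm (F x - F y) <= L * enorm (x - y).

Definition Sol F B : set 'rV[R]_n :=
  [set x | [set F x + b | b in B x] 0].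

Definition scale_op (l : R) T : 'rV[R]_n -> set 'rV[R]_n :=
  fun x => [set l *: b | b in T x].

(* (Id + T)^-1 as a function: z is mapped to the point y with z \in y + T y,
   which for a maximal monotone T exists and is unique by Minty's theorem; the
   value 0 is a dummy for other operators. *)
Definition resolvent T (z : 'rV[R]_n) : 'rV[R]_n :=
  xget 0 [set y | [set y + b | b in T y] z].

(* The nearest point, which exists and is unique for C nonempty, closed and
   convex; the value 0 is a dummy for other sets. *)
Definition eproj C (z : 'rV[R]_n) : 'rV[R]_n :=
  xget 0 [set p | C p /\ forall q, C q -> enorm (z - p) <= enorm (z - q)].

Definition natres F B (x : 'rV[R]_n) : 'rV[R]_n :=
  x - resolvent B (x - F x).

End Operators.

Record maegr_params (R : realType) (n : nat) := MAEGRParams {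
  pX : set 'rV[R]_n;
  peps : nat -> R;
  pa_lo : R;
  pa_hi : R;
  prho : R;
  pbeta : R;
  psigma : R;
  pm : R;
  pkappa : R;
  pM : R
}.

Definition valid_params (R : realType) (n : nat) (domF : set 'rV[R]_n)
    (B : 'rV[R]_n -> set 'rV[R]_n) (p : maegr_params R n) : Prop :=
  [/\ [/\ pX p !=set0, closed (pX p),
          convex_set (pX p : set (convex_lmodType 'rV[R]_n)),
          closure (op_dom B) `<=` pX p & pX p `<=` domF],
      (forall r, (1 <= r)%N -> 0 < peps p r) /\ peps p @ \oo --> (0 : R),
      0 < pa_lo p <= pa_hi p,
      [/\ 0 < prho p < 1 / 2, 0 < pbeta p < 1, 0 < psigma p < 1
        & 0 < pm p < 1] &
      0 <= pkappa p <= 2 /\ 1 < pM p].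

(* The quantities computed by the algorithm, indexed by epoch r and iteration
   k.  Entries (r, k) never reached by the algorithm are unconstrained. *)
Record maegr_trace (R : realType) (n : nat) := MAEGRTrace {
  tx : nat -> nat -> 'rV[R]_n;
  ty : nat -> nat -> 'rV[R]_n;
  td : nat -> nat -> 'rV[R]_n;
  tu : nat -> nat -> 'rV[R]_n;
  talpha : nat -> nat -> R;
  tlam : nat -> nat -> R;
  tLam : nat -> nat -> R
}.

Section Algorithm.
Variables (R : realType) (n : nat).
Variables (F : 'rV[R]_n -> 'rV[R]_n) (B : 'rV[R]_n -> set 'rV[R]_n).
Variables (p : maegr_params R n) (s : maegr_trace R n).

(* For iteration (r, k.+1) and a candidate stepsize l: the anchoring
   coefficient and the (trial) points x and y. *)
Definition tau_at r k (l : R) : R :=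
  l / ((1 - 2 * prho p) * tLam s r k + l).

Definition x_at r k (l : R) : 'rV[R]_n :=
  let t := tau_at r k l in
  eproj (pX p) (t *: tu s r k + (1 - t) *: (ty s r k - l *: td s r k)).

Definition y_at r k (l : R) : 'rV[R]_n :=
  let t := tau_at r k l in
  resolvent (scale_op l B)
    (t *: tu s r k + (1 - t) *: ty s r k - l *: F (x_at r k l)).

(* The stepsize bounds of epoch r, set at the end of its first iteration. *)
Definition lam_lo r : R := Num.min (pm p * tlam s r 1) (peps p r).
Definition lam_hi r : R := pM p * tlam s r 1.

(* The line search of iteration (r, 1) takes place before these bounds are set
   and still uses the initial ones (0, +oo). *)
Definition ls_lo r k : R := if k == 0%N then 0 else lam_lo r.
Definition ls_start r k : R :=
  if k == 0%N then talpha s r k.+1 else Num.min (talpha s r k.+1) (lam_hi r).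

Definition ls_step r k (j : nat) : R := ls_start r k * pbeta p ^+ j.

Definition ls_stop r k (j : nat) : Prop :=
  let l := ls_step r k j in
  l < ls_lo r k \/
  l * enorm (F (x_at r k l) - F (y_at r k l))
    <= psigma p * enorm (x_at r k l - y_at r k l).

Definition ls_least r k (j : nat) : Prop :=
  ls_stop r k j /\ forall i, (i < j)%N -> ~ ls_stop r k i.

(* The termination check preceding iteration (r, k.+1), on the iterate (r, k). *)
Definition terminates_at r k : Prop := enorm (natres F B (ty s r k)) = 0.

(* Iteration (r, k.+1) is entered and its line search ends. *)
Definition computes r k : Prop :=
  ~ terminates_at r k /\ exists j, ls_least r k j.

(* [arrives r k]: the algorithm arrives at the termination check with counters
   (r, k.+1); equivalently, iterate (r, k) belongs to the output sequence. *)
Inductive arrives : nat -> nat -> Prop :=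
| arrives_init : arrives 1 0
| arrives_next r k : arrives r k -> computes r k ->
    lam_lo r <= tlam s r k.+1 -> arrives r k.+1
| arrives_restart r k : arrives r k -> computes r k ->
    tlam s r k.+1 < lam_lo r -> arrives r.+1 0.

(* Iterate (r, k.+1) is computed and rejected, which triggers a restart. *)
Definition restarts_at r k : Prop :=
  [/\ arrives r k, computes r k & tlam s r k.+1 < lam_lo r].

Definition never_terminates : Prop :=
  forall r k, arrives r k -> ~ terminates_at r k.

Definition last_epoch r : Prop :=
  arrives r 0 /\ forall r' k, arrives r' k -> (r' <= r)%N.

Definition admissible_alpha r k : Prop :=
  0 < talpha s r k.+1 /\
  if k == 0%N then (pa_lo p <= talpha s r k.+1 <= pa_hi p : Prop)
  else (tlam s r k <= talpha s r k.+1 : Prop).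

Definition maeg_step r k : Prop :=
  forall j, ls_least r k j ->
  let l := tlam s r k.+1 in
  let t := tau_at r k l in
  [/\ l = ls_step r k j,
      tx s r k.+1 = x_at r k l /\ ty s r k.+1 = y_at r k l,
      tLam s r k.+1 = tLam s r k + l,
      td s r k.+1 = l^-1 *: (t *: tu s r k + (1 - t) *: ty s r k - ty s r k.+1)
                    - F (tx s r k.+1) + F (ty s r k.+1) &
      tu s r k.+1 = tu s r k - (prho p * l) *: td s r k.+1].

Definition starts_epoch r (z : 'rV[R]_n) : Prop :=
  [/\ tu s r 0 = z, tx s r 0 = z, ty s r 0 = z, td s r 0 = 0 & tLam s r 0 = 0].

Definition restart_point r k : 'rV[R]_n :=
  let u := tu s r k in let y := ty s r k in let d := td s r k in
  eproj (closure (op_dom B))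
    (u - (pkappa p * (dot (u - y) d / enorm d ^+ 2)) *: d).

(* s is an execution from x0.  That line searches end is not assumed: if one
   did not, the execution would be stuck there, and [arrives] would hold for
   no later counters. *)
Definition maegr_run (x0 : 'rV[R]_n) : Prop :=
  [/\ starts_epoch 1 x0,
      forall r k, arrives r k -> ~ terminates_at r k ->
        admissible_alpha r k /\ maeg_step r k &
      forall r k, restarts_at r k -> starts_epoch r.+1 (restart_point r k)].

End Algorithm.

(* Main.v *)
Require Import Defs.
From HB Require Import structures.
From mathcomp Require Import all_boot all_order all_algebra.
From mathcomp Require Import all_classical all_reals all_analysis.
From mathcomp Require Import ring lra.

Import Order.TTheory GRing.Theory Num.Theory.
Import numFieldNormedType.Exports.

(** Why the theorem is true.

    Resolvents and projections.  The trial points are only meaningful because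
    the resolvents of [B] and the projection on [X] exist.  Both facts come
    from one principle, [quad_sup_min]: a supremum of quadratics with Hessian
    the identity attains its minimum on a closed convex set, with quadratic
    growth around the minimizer.  With one quadratic this is the projection
    ([eprojP]); with the quadratics indexed by the graph of a monotone operator
    it yields Minty's theorem ([Minty]), following the proof that minimizes the
    Fitzpatrick function plus half the squared norm.

    Finitely many restarts.  By the Lipschitz bound the line search accepts
    every stepsize at most [sigma / L], so a stepsize obtained by backtracking
    exceeds [beta * sigma / L].  A stepsize accepted without backtracking is at
    least the previous one or the upper bound, hence at least the lower bound of
    its epoch.  A restart in epoch [r] therefore forces
    [beta * sigma / L < eps_r] ([restart_eps]), which fails for large [r], and
    an epoch contains at most one restart.

    The rate in the last epoch.  Write [a_k = (1 - 2 rho) Lam_k] and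
    [v_k = u_k - y_k]; for [k >= 1] the vector [d_k] belongs to
    [(F + B) (y_k)].  Monotonicity of [F + B] between consecutive iterates and
    the extragradient error estimate give [energy_step]: the quantity
    [P_k = <d_k, v_k> - a_k / 2 |d_k|^2] satisfies
    [(a_k + lam) P_(k+1) >= a_k P_k], so it stays nonnegative.  Against a
    solution [z] this gives [a_k / 2 |d_k|^2 <= <d_k, u_k - z>], from which
    follow the bound on [|d_k|] ([d_le]), the monotone decrease of [|u_k - z|]
    and a summable decrease ([anchor_step]).  The stepsizes of the epoch lie
    between two positive constants, so [Lam_k] grows linearly and the bound is
    O(1/k).

    From O to o.  The nonnegativity of [P_k] also says [a_k |d_k| <= 2 |v_k|],
    so it is enough that [v_k] tends to 0.  The anchored step contracts [|v|^2]
    by the factor [1 - tau_k] up to an error that [anchor_step] makes summable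
    ([gap_step]); as [tau_k] is at least a constant times [1/k] and the harmonic
    series diverges, [v_k] tends to 0 ([harmonic_contraction_cvg0],
    [gap_cvg0]). *)

Set Implicit Arguments.
Unset Strict Implicit.

Local Open Scope classical_set_scope.
Local Open Scope ring_scope.

(** * Euclidean inner product *)

Section Euclidean.
Context {R : realType} {n : nat}.
Implicit Types x y z : 'rV[R]_n.

Lemma dotC x y : dot x y = dot y x.
Proof. by apply: eq_bigr => i _; rewrite mulrC. Qed.

Lemma dotDl x y z : dot (x + y) z = dot x z + dot y z.
Proof. by rewrite -big_split; apply: eq_bigr => i _; rewrite mxE mulrDl. Qed.

Lemma dotDr x y z : dot x (y + z) = dot x y + dot x z.
Proof. by rewrite dotC dotDl !(dotC x). Qed.

Lemma dotZl a x y : dot (a *: x) y = a * dot x y.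
Proof. by rewrite mulr_sumr; apply: eq_bigr => i _; rewrite mxE mulrA. Qed.

Lemma dotZr a x y : dot x (a *: y) = a * dot x y.
Proof. by rewrite dotC dotZl dotC. Qed.

Lemma dotNl x y : dot (- x) y = - dot x y.
Proof. by rewrite -scaleN1r dotZl mulN1r. Qed.

Lemma dotNr x y : dot x (- y) = - dot x y.
Proof. by rewrite dotC dotNl dotC. Qed.

Lemma dot0l x : dot 0 x = 0.
Proof. by rewrite -(scale0r x) dotZl mul0r. Qed.

Definition dotE := (dotDl, dotDr, dotNl, dotNr, dotZl, dotZr).

Lemma dot_ge0 x : 0 <= dot x x.
Proof. by apply: sumr_ge0 => i _; rewrite -expr2 sqr_ge0. Qed.

Lemma dot_eq0 x : dot x x = 0 -> x = 0.
Proof.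
move=> x0; apply/rowP => i; rewrite mxE; apply/eqP.
have /psumr_eq0P := x0 => /(_ _ i isT) /eqP.
by rewrite mulf_eq0 orbb; apply => j _; rewrite -expr2 sqr_ge0.
Qed.

Lemma enorm_ge0 x : 0 <= enorm x.
Proof. exact: sqrtr_ge0. Qed.

Lemma enorm_sqr x : enorm x ^+ 2 = dot x x.
Proof. by rewrite sqr_sqrtr// dot_ge0. Qed.

Lemma ler_enorm x y : (enorm x <= enorm y) = (dot x x <= dot y y).
Proof. by rewrite ler_sqrt// dot_ge0. Qed.

Lemma dot_Young (c : R) x y : 0 < c ->
  2 * dot x y <= c * dot x x + c^-1 * dot y y.
Proof.
move=> c0; have := dot_ge0 (c *: x - y).
rewrite !dotE (dotC y x) => h; rewrite -subr_ge0.
have -> : c * dot x x + c^-1 * dot y y - 2 * dot x y =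
  c^-1 * (c * (c * dot x x) - c * dot x y - c * dot x y + dot y y).
  by field; rewrite gt_eqF.
rewrite mulr_ge0 ?invr_ge0 ?(ltW c0)//; lra.
Qed.

Lemma dot_cauchy x y : dot x y <= enorm x * enorm y.
Proof.
have x0 := enorm_ge0 x; have y0 := enorm_ge0 y.
have := dot_ge0 (enorm y *: x - enorm x *: y).
rewrite !dotE (dotC y x) -!enorm_sqr => h.
case: (eqVneq (enorm x * enorm y) 0) => [/eqP|xy0].
  rewrite mulf_eq0 => /orP[] /eqP e0.
    have /dot_eq0 -> : dot x x = 0 by rewrite -enorm_sqr e0 expr0n.
    by rewrite dot0l mulr_ge0 ?enorm_ge0.
  have /dot_eq0 -> : dot y y = 0 by rewrite -enorm_sqr e0 expr0n.
  by rewrite dotC dot0l mulr_ge0 ?enorm_ge0.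
have xy_gt0 : 0 < enorm x * enorm y by rewrite lt_def xy0 mulr_ge0.
rewrite -(ler_pM2l xy_gt0); nra.
Qed.

Lemma dot_continuous {T : topologicalType} (f g : T -> 'rV[R]_n) :
  continuous f -> continuous g -> continuous (fun t => dot (f t) (g t)).
Proof.
move=> cf cg t; rewrite /continuous_at /dot.
elim: (index_enum _) => [|i r IH].
  by rewrite big_nil; under eq_fun do rewrite big_nil; exact: cvg_cst.
rewrite big_cons; under eq_fun do rewrite big_cons.
apply: cvgD; last exact: IH.
apply: cvgM.
  exact: (@continuous_comp _ _ _ f (fun v : 'rV[R]_n => v 0 i) t (cf t)
    (@coord_continuous _ _ _ _ _ _)).
exact: (@continuous_comp _ _ _ g (fun v : 'rV[R]_n => v 0 i) t (cg t)
  (@coord_continuous _ _ _ _ _ _)).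
Qed.

Lemma dot_bounded (A : set 'rV[R]_n) (c : R) :
  (forall x, A x -> dot x x <= c) -> bounded_set A.
Proof.
move=> Ac; exists (c + 1); split; first exact: num_real.
move=> M cM x /Ac xc.
have c0 : 0 <= c := le_trans (dot_ge0 x) xc.
rewrite /= [leLHS]/Num.norm/= mx_normrE; apply: bigmax_le => [|[i j] _] /=.
  by lra.
rewrite (ord1 i) ler_norml.
have : x 0 j * x 0 j <= c.
  apply: le_trans xc; rewrite /dot (bigD1 j)//= lerDl.
  by apply: sumr_ge0 => k _; rewrite -expr2 sqr_ge0.
move=> h; apply/andP; split; nra.
Qed.

End Euclidean.

(** * Suprema of quadratics and projections *)

Section QuadraticMinimum.
Context {R : realType} {n : nat}.
Variables (C : set 'rV[R]_n) (I : set ('rV[R]_n * R)).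
Hypotheses (C_closed : closed C)
  (C_convex : convex_set (C : set (convex_lmodType 'rV[R]_n))).

(** [t] bounds at [p] every quadratic [|p + q|^2 / 2 - k] with [(q, k)] in [I].
    Bounding the supremum instead of taking it avoids infinite values. *)
Definition quad_le (p : 'rV[R]_n) (t : R) : Prop :=
  C p /\ forall i, I i -> 2^-1 * dot (p + i.1) (p + i.1) - i.2 <= t.

Lemma quad_epi_closed : closed [set z : 'rV[R]_n * R | quad_le z.1 z.2].
Proof.
have -> : [set z | quad_le z.1 z.2] =
    fst @^-1` C `&` \bigcap_(i in I)
      ((fun z : 'rV[R]_n * R => 2^-1 * dot (z.1 + i.1) (z.1 + i.1) - i.2 - z.2)
         @^-1` [set t | t <= 0]).
  apply/seteqP; split => z /= [Cz Iz]; split => // i Ii; have := Iz i Ii => /=.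
    by rewrite subr_le0.
  by rewrite subr_le0.
apply: closedI; first by apply: preimage_closed => //= z _; exact: cvg_fst.
apply: closed_bigI => i _; apply: preimage_closed; last exact: closed_le.
move=> z _; apply: cvgB; last exact: cvg_snd.
apply: cvgB; last exact: cvg_cst.
apply: cvgM; first exact: cvg_cst.
have cf : continuous (fun w : 'rV[R]_n * R => w.1 + i.1).
  by move=> w; apply: cvgD; [exact: cvg_fst|exact: cvg_cst].
exact: (dot_continuous cf cf).
Qed.

(** Strong convexity: the squared norm turns the convexity inequality into an
    identity with an explicit gain. *)
Lemma quad_le_conv (s : R) p q t u : 0 < s < 1 -> quad_le p t -> quad_le q u ->
  quad_le ((1 - s) *: p + s *: q)
    ((1 - s) * t + s * u - s * (1 - s) * (2^-1 * dot (q - p) (q - p))).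
Proof.
move=> /andP[s0 s1] [Cp pt] [Cq qu]; split.
  have /(_ q p (Itv01 (ltW s0) (ltW s1))) := C_convex.
  by rewrite !inE addrC; apply.
move=> i Ii; have := pt i Ii; have := qu i Ii.
have -> : dot ((1 - s) *: p + s *: q + i.1) ((1 - s) *: p + s *: q + i.1) =
    (1 - s) * dot (p + i.1) (p + i.1) + s * dot (q + i.1) (q + i.1)
    - s * (1 - s) * dot (q - p) (q - p).
  by rewrite !dotE (dotC q p) !(dotC i.1); ring.
nra.
Qed.

(** A minimizer exists by compactness of the part of the epigraph below a given
    value; letting [s] tend to 0 in [quad_le_conv] gives the quadratic
    growth. *)
Lemma quad_sup_min : I !=set0 -> (exists p t, quad_le p t) ->
  exists p0 t0, quad_le p0 t0 /\
    forall p t, quad_le p t -> t0 + 2^-1 * dot (p - p0) (p - p0) <= t.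
Proof.
move=> [i Ii] [p1 [t1 pt1]].
pose K := [set p : 'rV[R]_n | dot p p <= 4 * (t1 + i.2) + 2 * dot i.1 i.1].
pose E := [set z : 'rV[R]_n * R | quad_le z.1 z.2] `&`
  (K `*` `[- i.2, t1]%classic).
have lo p t : quad_le p t -> - i.2 <= t.
  by move=> [_ /(_ i Ii)]; have := dot_ge0 (p + i.1); lra.
have inE1 p t : quad_le p t -> t <= t1 -> E (p, t).
  move=> pt tt1; split => //; split => /=; last first.
    by rewrite in_itv/= tt1 andbT (lo p).
  rewrite /K/=; case: pt => _ /(_ i Ii).
  by have := dot_ge0 (p + 2 *: i.1); rewrite !dotE (dotC i.1 p); lra.
have Kc : compact K.
  apply: bounded_closed_compact; first by apply: dot_bounded => p; exact: id.
  apply: (@preimage_closed _ _ (fun p : 'rV[R]_n => dot p p)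
    [set t | t <= 4 * (t1 + i.2) + 2 * dot i.1 i.1]); last exact: closed_le.
  move=> p _; have idc : continuous (@id 'rV[R]_n) by move=> q; exact: cvg_id.
  exact: (dot_continuous idc idc).
have Ec : compact E.
  rewrite /E setIC; apply: compact_closedI; last exact: quad_epi_closed.
  by apply: compact_setX => //; exact: segment_compact.
have [|//|[p0 t0] /[!inE] Ep0 min0] := @compact_EVT_min _ _ snd E _ Ec.
- by exists (p1, t1); exact: inE1.
- by apply: continuous_subspaceT => z; exact: cvg_snd.
have {}min0 p t : quad_le p t -> t0 <= t.
  move=> pt; have [tt1|t1t] := leP t t1.
    by have := min0 (p, t); apply; rewrite inE; exact: inE1.
  by case: Ep0 => _ [_]; rewrite /= in_itv/= => /andP[_ /le_trans]; apply; exact: ltW.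
exists p0, t0; split; first by case: Ep0.
move=> p t pt; have p0t0 : quad_le p0 t0 by case: Ep0.
set D := _ * dot _ _.
have D0 : 0 <= D by rewrite mulr_ge0 ?dot_ge0// invr_ge0.
have key s : 0 < s < 1 -> (1 - s) * D <= t - t0.
  move=> s01; have := min0 _ _ (quad_le_conv s01 p0t0 pt).
  rewrite -/D; case/andP: s01 => s0 s1 h.
  by rewrite -(ler_pM2l s0); lra.
rewrite addrC -lerBrDr leNgt; apply/negP => Dt.
have h0 := min0 _ _ pt.
have D1 : 0 < D by lra.
(* this value of [s] makes [(1 - s) * D] the midpoint of [t - t0] and [D] *)
have : 0 < (D - (t - t0)) / (2 * D) < 1.
  by rewrite divr_gt0 ?ltr_pdivrMr; lra.
move/key; rewrite mulrBl mul1r.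
have -> : (D - (t - t0)) / (2 * D) * D = (D - (t - t0)) / 2.
  by field; rewrite gt_eqF.
lra.
Qed.
End QuadraticMinimum.

(** The minimum of the single quadratic [|p - z|^2 / 2]; its quadratic growth is
    exactly the variational inequality. *)
Lemma eprojP {R : realType} {n : nat} (C : set 'rV[R]_n) (z : 'rV[R]_n) :
    C !=set0 -> closed C -> convex_set (C : set (convex_lmodType 'rV[R]_n)) ->
  C (eproj C z) /\
  forall q, C q -> dot (z - eproj C z) (q - eproj C z) <= 0.
Proof.
move=> [c Cc] Ccl Ccv.
pose I : set ('rV[R]_n * R) := [set (- z, 0)].
have leE p t : quad_le C I p t <-> C p /\ 2^-1 * dot (z - p) (z - p) <= t.
  have E : dot (z - p) (z - p) = dot (p - z) (p - z).
    by rewrite -[z - p]opprB dotNl dotNr opprK.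
  rewrite E; split=> [[Cp /(_ _ (erefl _))]|[Cp pt]]; first by rewrite /= subr0.
  by split=> // _ ->; rewrite /= subr0.
have [||p0 [t0 [/leE[Cp0 p0t0] min0]]] := @quad_sup_min _ _ C I Ccl Ccv.
- by exists (- z, 0).
- by exists c, (2^-1 * dot (z - c) (z - c)); apply/leE.
have [Cp pmin] : C (eproj C z) /\
    forall q, C q -> enorm (z - eproj C z) <= enorm (z - q).
  rewrite /eproj; case: xgetP => [p _ //|/(_ p0)]; case; split => // q Cq.
  have /min0 : quad_le C I q (2^-1 * dot (z - q) (z - q)) by apply/leE.
  by rewrite ler_enorm; have := dot_ge0 (q - p0); lra.
move: (eproj C z) Cp pmin => p Cp pmin.
have -> : p = p0.
  have := pmin _ Cp0; rewrite ler_enorm => pp0.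
  have /min0 h : quad_le C I p (2^-1 * dot (z - p) (z - p)) by apply/leE.
  apply/eqP; rewrite -subr_eq0; apply/eqP/dot_eq0/le_anti.
  by rewrite dot_ge0 andbT; lra.
split => // q Cq.
have /min0 : quad_le C I q (2^-1 * dot (z - q) (z - q)) by apply/leE.
suff : dot (z - q) (z - q) =
  dot (z - p0) (z - p0) + dot (q - p0) (q - p0) - 2 * dot (z - p0) (q - p0).
  lra.
by rewrite !dotE (dotC q z) (dotC p0 z) (dotC p0 q); ring.
Qed.

(** * Minty's theorem and resolvents *)

Section Minty.
Context {R : realType} {n : nat}.
Implicit Types T : 'rV[R]_n -> set 'rV[R]_n.

(** Maximality, stated on points of the graph. *)
Definition monotone_closed T : Prop := forall x b,
  (forall y c, T y c -> 0 <= dot (b - c) (x - y)) -> T x b.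

Lemma maximal_monotone_closed T : maximal_monotone_op T -> monotone_closed T.
Proof.
move=> [Tm Tmax] x b xb.
pose T' := fun y => T y `|` [set c | y = x /\ c = b].
suff <- : T' = T by right.
apply: Tmax; last by move=> y c; left.
move=> y1 y2 c1 c2 [T1|[-> ->]] [T2|[-> ->]]; first exact: Tm.
- by have := xb _ _ T1; rewrite -(opprB b) -(opprB x) dotNl dotNr opprK.
- exact: xb.
- by rewrite !subrr dot0l.
Qed.

Lemma dot_row_mx (a b c d : 'rV[R]_n) :
  dot (row_mx a b) (row_mx c d) = dot a c + dot b d.
Proof.
rewrite /dot big_split_ord/=.
by congr (_ + _); apply: eq_bigr => i _; rewrite ?row_mxEl ?row_mxEr.
Qed.

(** Minimize over [(w, v)] the supremum over the graph of
    [<b, w> + <v, x> - <b, x> + |w|^2 / 2 + |v|^2 / 2], the Fitzpatrick function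
    plus half the squared norm.  By maximality its minimum is at least
    [|w + v|^2 / 2], and quadratic growth evaluated on the graph then says
    [|w + v|^2 <= <b + w, x + v>].  So [(- v, - w)] is monotonically related to
    the graph, hence on it, and taking it for [(x, b)] gives [w = - v]. *)
Lemma Minty0 T : monotone_op T -> monotone_closed T -> (exists x b, T x b) ->
  exists y, T y (- y).
Proof.
move=> Tm Tc [x0 [b0 Txb0]].
pose I : set ('rV[R]_(n + n) * R) :=
  [set i | exists x b, T x b /\ i = (row_mx b x, 2^-1 * dot (x + b) (x + b))].
have leE w v t : quad_le setT I (row_mx w v) t <-> forall x b, T x b ->
    dot b w + dot v x - dot b x + 2^-1 * dot w w + 2^-1 * dot v v <= t.
  have E x b : 2^-1 * dot (row_mx w v + row_mx b x) (row_mx w v + row_mx b x)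
        - 2^-1 * dot (x + b) (x + b) =
      dot b w + dot v x - dot b x + 2^-1 * dot w w + 2^-1 * dot v v.
    by rewrite add_row_mx dot_row_mx !dotE (dotC w b) (dotC x v) (dotC x b); field.
  split=> [[_ h] x b Txb|h].
    by have := h (row_mx b x, 2^-1 * dot (x + b) (x + b)); rewrite E; apply; exists x, b.
  by split=> // _ [x [b [Txb ->]]]; rewrite E; exact: h.
have graph_le x b : T x b ->
    quad_le setT I (row_mx x b) (2^-1 * dot (x + b) (x + b)).
  move=> Txb; apply/leE => y c Tyc; have := Tm _ _ _ _ Txb Tyc.
  by rewrite !dotE (dotC x b); lra.
have [|||p0 [t0 [p0t0 min0]]] := @quad_sup_min _ _ setT I closedT.
- by move=> x y l _ _; rewrite inE.
- by exists (row_mx b0 x0, 2^-1 * dot (x0 + b0) (x0 + b0)), x0, b0.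
- by exists (row_mx x0 b0), (2^-1 * dot (x0 + b0) (x0 + b0)); exact: graph_le.
rewrite -(hsubmxK p0) in p0t0 min0.
move: (lsubmx p0) (rsubmx p0) p0t0 min0 => w v /leE wvt0 min0.
(* the Fitzpatrick function of a maximal monotone operator is at least the
   duality pairing *)
have t0_ge : 2^-1 * dot (w + v) (w + v) <= t0.
  have [Twv|nTwv] := pselect (T w v).
    by have := wvt0 _ _ Twv; rewrite !dotE (dotC w v); lra.
  have [x [b [Txb lt0]]] : exists x b, T x b /\ dot (v - b) (w - x) < 0.
    apply: contrapT => h; apply/nTwv/Tc => x b Txb.
    by rewrite leNgt; apply/negP => h'; apply: h; exists x, b.
  have := wvt0 _ _ Txb; move: lt0; rewrite !dotE (dotC w v) (dotC v x).
  by have := dotC v x; lra.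
have main x b : T x b -> dot (w + v) (w + v) <= dot (b + w) (x + v).
  move=> /graph_le/min0; rewrite opp_row_mx add_row_mx dot_row_mx.
  move: t0_ge; rewrite !dotE.
  have := dotC v w; have := dotC w x; have := dotC b x; have := dotC v b.
  have := dotC x v; have := dotC w b; lra.
have Tvw : T (- v) (- w).
  apply: Tc => x b /main; have := dot_ge0 (w + v) => h1 h2.
  by rewrite -!opprD dotNl dotNr opprK (addrC w) (addrC v); lra.
have := main _ _ Tvw; rewrite addNr dot0l => h.
have /dot_eq0/eqP : dot (w + v) (w + v) = 0 by apply/le_anti; rewrite h dot_ge0.
rewrite addr_eq0 => /eqP wv; exists (- v).
by rewrite -wv in Tvw *.
Qed.

(** Translation by [z] and scaling by [l] reduce to [Minty0]. *)
Lemma Minty T (l : R) z : monotone_op T -> monotone_closed T ->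
  op_dom T !=set0 -> 0 < l -> exists y b, T y b /\ y + l *: b = z.
Proof.
move=> Tm Tc [x0 [b0 Txb0]] l0.
pose S : 'rV[R]_n -> set 'rV[R]_n := fun y => [set c | T y (l^-1 *: (c + z))].
have li : 0 < l^-1 by rewrite invr_gt0.
have [|||y Sy] := @Minty0 S.
- move=> x y a b /= Ta Tb; have := Tm _ _ _ _ Ta Tb.
  rewrite -scalerBr dotZl pmulr_rge0//.
  by rewrite opprD addrACA subrr addr0.
- move=> x b xb; apply: Tc => y c Tyc.
  have /(xb y) : S y (l *: c - z).
    by rewrite /S/= subrK scalerA mulVf ?scale1r// gt_eqF.
  have -> : b - (l *: c - z) = l *: (l^-1 *: (b + z) - c).
    by rewrite scalerBr scalerA divff ?gt_eqF// scale1r opprB addrA.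
  by rewrite dotZl pmulr_rge0.
- exists x0, (l *: b0 - z).
  by rewrite /S/= subrK scalerA mulVf ?scale1r// gt_eqF.
exists y, (l^-1 *: (- y + z)); split => //.
by rewrite scalerA divff ?gt_eqF// scale1r addrA subrr add0r.
Qed.

Lemma resolventP T (l : R) z : maximal_monotone_op T -> op_dom T !=set0 ->
  0 < l -> exists2 b, T (resolvent (scale_op l T) z) b &
    resolvent (scale_op l T) z + l *: b = z.
Proof.
move=> Tmax T0 l0; rewrite /resolvent.
case: xgetP => [y _ [c [b Tb <-] <-]|]; first by exists b.
have [y [b [Tb yb]]] := @Minty T l z Tmax.1 (maximal_monotone_closed Tmax) T0 l0.
by move=> /(_ y); case; exists (l *: b) => //; exists b.
Qed.

(** If [j] is the resolvent at [y - F y], then [y - F y - j] is in [T j];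
    monotonicity against [T y b] gives [|y - j|^2 <= <F y + b, y - j>]. *)
Lemma natres_le T F y b : maximal_monotone_op T -> T y b ->
  enorm (natres F T y) <= enorm (F y + b).
Proof.
move=> Tmax Tyb.
have sc1 : scale_op 1 T = T.
  apply/funext => x; rewrite /scale_op; apply/seteqP; split => c /=.
    by case=> c' Tc <-; rewrite scale1r.
  by move=> Tc; exists c => //; rewrite scale1r.
have [|c] := @resolventP T 1 (y - F y) Tmax _ ltr01; first by exists y, b.
rewrite sc1 /natres scale1r; move: (resolvent _ _) => j Tc jc.
have := Tmax.1 _ _ _ _ Tyb Tc.
have -> : b - c = F y + b - (y - j).
  apply/rowP => i; have /rowP/(_ i) := jc; rewrite !mxE; lra.
set d := F y + b; rewrite dotDl dotNl subr_ge0 => h.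
have h2 := @dot_Young R n 1 d (y - j) ltr01.
by rewrite ler_enorm; move: h2; rewrite invr1 !mul1r; lra.
Qed.
End Minty.

(** * One anchored extragradient step *)

Section Step.
Context {R : realType} {n : nat}.
Implicit Types (D e h : 'rV[R]_n).

(** Here [h] is the gap between the two trial points, and [D + e] the
    displacement of the point that is projected relative to [y]. *)
Lemma proj_gap_le D e h : 0 <= dot (D + e - h) h ->
  dot h h <= dot D D + 2 * dot D e + dot e e.
Proof.
move=> hp; have := dot_ge0 (D + e - h).
by move: hp; rewrite !dotE (dotC e D) (dotC h D) (dotC h e); lra.
Qed.

Variable sigma : R.
Hypothesis sigma01 : 0 < sigma < 1.

(** The value is not optimized; what counts in [err_le] is that it depends on
    [sigma] only. *)
Definition err_const : R := 4 / (1 - sigma ^+ 2) ^+ 2 + 2 / (1 - sigma ^+ 2).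

Lemma err_const_ge0 : 0 <= err_const.
Proof.
have s2 : 0 < 1 - sigma ^+ 2 by case/andP: sigma01 => *; nra.
by rewrite addr_ge0// divr_ge0// ?exprn_ge0// ltW.
Qed.

Lemma err_le D e h : 0 <= dot (D + e - h) h ->
  dot e e <= sigma ^+ 2 * dot h h -> dot e e <= err_const * dot D D.
Proof.
move=> /proj_gap_le hh ee.
have s2 : 0 < 1 - sigma ^+ 2 by case/andP: sigma01 => *; nra.
have s21 : sigma ^+ 2 <= 1 by lra.
have s20 : 0 <= sigma ^+ 2 by exact: sqr_ge0.
rewrite /err_const; set k := 1 - sigma ^+ 2 in s2 *.
(* this weight lets half of [k |e|^2] be absorbed on the left *)
have := @dot_Young _ _ (2 / k) D e (divr_gt0 (ltr0Sn R 1) s2).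
rewrite invf_div => Y.
have ek : dot e e * (k / 2) <= dot D D * (1 + 2 / k).
  have E1 : dot e e <= sigma ^+ 2 * (dot D D + (2 / k * dot D D + k / 2 * dot e e) + dot e e).
    by apply: (le_trans ee); apply: ler_wpM2l => //; lra.
  have X0 : 0 <= dot D D + (2 / k * dot D D + k / 2 * dot e e).
    have h0 := dot_ge0 h; have e0 := dot_ge0 e; have d0 := dot_ge0 D.
    have k2 : 0 <= 2 / k by rewrite divr_ge0// ltW.
    have k3 : 0 <= k / 2 by rewrite divr_ge0// ltW.
    by rewrite addr_ge0// addr_ge0// mulr_ge0.
  have -> : dot e e * (k / 2) = dot e e * k - k / 2 * dot e e by field.
  have -> : dot e e * k = dot e e - sigma ^+ 2 * dot e e by rewrite /k; ring.
  nra.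
rewrite -(ler_pM2r (divr_gt0 s2 (ltr0Sn _ 1))); apply: (le_trans ek).
rewrite le_eqVlt; apply/orP; left; apply/eqP; field.
by rewrite gt_eqF.
Qed.

Variables (rho a l : R) (u y d x y' d' g : 'rV[R]_n).
Hypotheses (a_ge0 : 0 <= a) (l_gt0 : 0 < l).
Let tau := l / (a + l).
Let u' := u - (rho * l) *: d'.
Hypothesis y'E : y' = tau *: u + (1 - tau) *: y - l *: (d' + g).
Hypothesis x_proj :
  dot (tau *: u + (1 - tau) *: (y - l *: d) - x) (y' - x) <= 0.
Hypothesis ls : l * enorm g <= sigma * enorm (x - y').

Let al_gt0 : 0 < a + l. Proof. exact: ltr_wpDl. Qed.
Let al : a + l != 0. Proof. by rewrite gt_eqF. Qed.
Let l0 : l != 0. Proof. by rewrite gt_eqF. Qed.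

(** [tau *: q] is [l *: (d' - (1 - tau) *: d)], the displacement from [y'] of the
    point projected to obtain [x], up to the extrapolation error [l *: g]. *)
Let q := (a + l) *: d' - a *: d.

Let gapE : 0 <= dot (tau *: q + l *: g - (x - y')) (x - y').
Proof.
move: x_proj; rewrite -(opprB x y') dotNr oppr_le0.
congr (_ <= dot _ _); apply/rowP => i; have /rowP/(_ i) := y'E.
by rewrite /q /tau !mxE => ->; field.
Qed.

Let errE : dot (l *: g) (l *: g) <= sigma ^+ 2 * dot (x - y') (x - y').
Proof.
rewrite dotZl dotZr mulrA -expr2 -!enorm_sqr -!exprMn.
case/andP: sigma01 => s0 _.
by rewrite lerXn2r// nnegrE mulr_ge0// ?enorm_ge0// ltW.
Qed.

(** Since [u - y'] and [u - y] are both combinations of [y' - y] and [d' + g],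
    the difference of the two energies is a multiple of
    [<d' - d, y' - y> >= 0] plus [(a + l) <q, d' + g>].  The line search gives
    [2 (a + l) <q, g> >= - |q|^2], and what remains telescopes in
    [(a + l)^2 |d'|^2 - a^2 |d|^2].  The term [rho] accounts for the move of the
    anchor from [u] to [u']. *)
Lemma energy_step : 0 <= a * dot (d' - d) (y' - y) ->
  a * (dot d (u - y) - a / 2 * dot d d) <=
  (a + l) * (dot d' (u' - y') - (a + (1 - 2 * rho) * l) / 2 * dot d' d').
Proof.
move=> mono.
have [v'E vE] : u - y' = (a / l) *: (y' - y) + (a + l) *: (d' + g) /\
    u - y = ((a + l) / l) *: (y' - y) + (a + l) *: (d' + g).
  by split; apply/rowP => i; have /rowP/(_ i) := y'E;
    rewrite /tau !mxE => ->; field; rewrite l0 al.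
have qg : - dot q q <= 2 * ((a + l) * dot q g).
  have hh := proj_gap_le gapE.
  have : 0 <= dot (tau *: q) (tau *: q) + 2 * dot (tau *: q) (l *: g).
    case/andP: sigma01 => s0 s1; have := dot_ge0 (x - y') => h0.
    have s2 : sigma ^+ 2 <= 1 by nra.
    by have := ler_wpM2r h0 s2; move: errE hh; lra.
  have -> : dot (tau *: q) (tau *: q) + 2 * dot (tau *: q) (l *: g) =
      tau ^+ 2 * (dot q q + 2 * ((a + l) * dot q g)).
    by rewrite !dotE /tau; field.
  have t2 : 0 < tau ^+ 2 by rewrite exprn_gt0// divr_gt0.
  by rewrite pmulr_rge0//; lra.
have -> : dot d' (u' - y') = dot d' (u - y') - rho * l * dot d' d'.
  by rewrite /u' !dotE; ring.
rewrite v'E vE.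
have -> : (a + l) * (dot d' ((a / l) *: (y' - y) + (a + l) *: (d' + g))
    - rho * l * dot d' d' - (a + (1 - 2 * rho) * l) / 2 * dot d' d') =
  (a + l) / l * (a * dot (d' - d) (y' - y)) +
  a * dot d (((a + l) / l) *: (y' - y) + (a + l) *: (d' + g))
  + (a + l) * dot q (d' + g) - (a + l) ^+ 2 / 2 * dot d' d'.
  by rewrite /q !dotE; field.
have m0 : 0 <= (a + l) / l * (a * dot (d' - d) (y' - y)).
  by apply: mulr_ge0 => //; apply: divr_ge0; exact: ltW.
have qq : dot q q = (a + l) ^+ 2 * dot d' d'
    - 2 * ((a + l) * a * dot d d') + a ^+ 2 * dot d d.
  by rewrite /q !dotE (dotC d' d); ring.
have qd' : dot q (d' + g) = (a + l) * dot d' d' - a * dot d d' + dot q g.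
  by rewrite /q !dotE; ring.
move: m0 qg; rewrite qd' qq.
move: (dot q g) (dot d (_ + _)) (_ / _ * (_ * _)) => A V M; lra.
Qed.

(** [u' - y'] is the convex combination with weight [tau] of [u - y] and of a
    vector whose size is controlled by [(a + l) |d'|] and [a |d|]. *)
Lemma gap_step : 0 <= rho <= 1 ->
  dot (u' - y') (u' - y') <= (1 - tau) * dot (u - y) (u - y) +
    tau * ((2 + 4 * err_const) *
             (a ^+ 2 * dot d d + (a + l) ^+ 2 * dot d' d')).
Proof.
move=> /andP[rho0 rho1].
pose r := ((1 - rho) * (a + l)) *: d' + (a + l) *: g.
have -> : u' - y' = (1 - tau) *: (u - y) + tau *: r.
  by apply/rowP => i; have /rowP/(_ i) := y'E;
    rewrite /r /u' /tau !mxE => ->; field.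
have tau01 : 0 <= tau <= 1.
  by rewrite divr_ge0 ?ler_pdivrMr ?mul1r ?lerDr// ltW.
have gq : (a + l) ^+ 2 * dot g g <= err_const * dot q q.
  have := err_le gapE errE; rewrite !dotE => h.
  have t2 : 0 < tau ^+ 2 by rewrite exprn_gt0// divr_gt0.
  rewrite -(ler_pM2l t2); apply: le_trans (le_trans h _).
    by rewrite le_eqVlt /tau; apply/orP; left; apply/eqP; field.
  by rewrite le_eqVlt; apply/orP; left; apply/eqP; ring.
have rr : dot r r <= (2 + 4 * err_const) *
             (a ^+ 2 * dot d d + (a + l) ^+ 2 * dot d' d').
  have r1 := dot_ge0 (((1 - rho) * (a + l)) *: d' - (a + l) *: g).
  have q1 := dot_ge0 ((a + l) *: d' + a *: d).
  have rE : dot r r <= 2 * ((1 - rho) ^+ 2 * ((a + l) ^+ 2 * dot d' d')) +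
      2 * ((a + l) ^+ 2 * dot g g).
    by move: r1; rewrite /r !dotE (dotC g d'); lra.
  have qE : dot q q <= 2 * ((a + l) ^+ 2 * dot d' d') + 2 * (a ^+ 2 * dot d d).
    by move: q1; rewrite /q !dotE (dotC d' d); lra.
  have ad : 0 <= a ^+ 2 * dot d d by rewrite mulr_ge0 ?dot_ge0 ?sqr_ge0.
  have sd : 0 <= (a + l) ^+ 2 * dot d' d' by rewrite mulr_ge0 ?dot_ge0 ?sqr_ge0.
  have K0 := err_const_ge0.
  have r01 : (1 - rho) ^+ 2 <= 1 by nra.
  have h2 := ler_wpM2l K0 qE; have h1 := ler_wpM2r sd r01.
  have -> : (2 + 4 * err_const) * (a ^+ 2 * dot d d + (a + l) ^+ 2 * dot d' d') =
      2 * (a ^+ 2 * dot d d) + 2 * (1 * ((a + l) ^+ 2 * dot d' d')) +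
      2 * (err_const * (2 * ((a + l) ^+ 2 * dot d' d') + 2 * (a ^+ 2 * dot d d))).
    by ring.
  by move: rE gq ad h1 h2; move: (_ * dot g g) (a ^+ 2 * _)
    (_ * (_ * dot d' d')) (err_const * _) (err_const * _) (1 * _) => *; lra.
case/andP: tau01 => t0 t1.
apply: (@le_trans _ _ ((1 - tau) * dot (u - y) (u - y) + tau * dot r r)); last first.
  by rewrite lerD2l ler_wpM2l.
move: (u - y) r {rr} => v r.
have : 0 <= tau * (1 - tau) * dot (v - r) (v - r).
  by apply: mulr_ge0; [apply: mulr_ge0; rewrite ?subr_ge0|exact: dot_ge0].
by rewrite !dotE (dotC r v); lra.
Qed.
End Step.

(** * Contraction with harmonic factors *)

(** [s + W] and [W] decrease, so [s] converges; a positive limit would bound the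
    partial sums of the harmonic series. *)
Lemma harmonic_contraction_cvg0 {R : realType} (s W : nat -> R) (c : R) :
    0 < c -> (forall k, 0 <= s k) -> (forall k, 0 <= W k) ->
    (forall k, W k.+1 <= W k) ->
    (forall k, s k.+1 + W k.+1 <= s k + W k - c / k.+1%:R * s k) ->
  s @ \oo --> (0 : R).
Proof.
move=> c0 s0 W0 Wd step.
have dec k : s k.+1 + W k.+1 <= s k + W k.
  apply: (le_trans (step k)); rewrite lerBlDr lerDl.
  by apply: mulr_ge0 => //; apply: divr_ge0; rewrite ?ler0n ?ltW.
have Wc : cvgn W.
  apply: nonincreasing_is_cvgn; first exact/nonincreasing_seqP.
  by exists 0 => _ [k _ <-].
have Gc : cvgn (fun k => s k + W k).
  apply: nonincreasing_is_cvgn; first exact/nonincreasing_seqP.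
  by exists 0 => _ [k _ <-]; exact: addr_ge0.
have sc : cvgn s.
  have -> : s = (fun k => s k + W k) \- W by apply/funext => k /=; rewrite addrK.
  exact: is_cvgB.
suff /eqP l0 : limn s == 0 by rewrite -l0.
rewrite eq_le; apply/andP; split; last first.
  by apply: limr_ge => //; apply: nearW.
rewrite leNgt; apply/negP => l0.
have [N _ sN] : \forall k \near \oo, limn s / 2 <= s k.
  apply: (@cvgr_ge _ _ _ _ s (limn s)); first exact: sc.
  by rewrite ltr_pdivrMr// ltr_pMr// ltr1n.
have l2 : 0 < c * (limn s / 2) by rewrite mulr_gt0// divr_gt0.
apply: (@dvg_harmonic R); rewrite -(is_cvg_series_restrict N).
apply: nondecreasing_is_cvgn.
  by apply: nondecreasing_series => j _ _; exact: harmonic_ge0.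
exists ((s N + W N) / (c * (limn s / 2))) => _ [m _ <-] /=.
rewrite ler_pdivlMr//.
have [mN|/ltnW/subnKC <-] := leqP m N.
  by rewrite big_geq// mul0r addr_ge0.
suff : (\sum_(N <= j < N + (m - N)) harmonic j) * (c * (limn s / 2)) +
    (s (N + (m - N))%N + W (N + (m - N))%N) <= s N + W N.
  by move=> h; rewrite (le_trans _ h)// lerDl addr_ge0.
elim: (m - N)%N => [|k /= IH]; first by rewrite addn0 big_geq// mul0r add0r.
rewrite addnS big_nat_recr ?leq_addr//= mulrDl.
have h1 := step (N + k)%N.
have h2 : (N + k).+1%:R^-1 * (c * (limn s / 2)) <= c / (N + k).+1%:R * s (N + k)%N.
  have -> : (N + k).+1%:R^-1 * (c * (limn s / 2)) =
    c / (N + k).+1%:R * (limn s / 2) by ring.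
  apply: ler_wpM2l; last exact/sN/leq_addr.
  by apply: divr_ge0; rewrite ?ler0n ?ltW.
set p := _^-1 * _ in h2 *; set q := c / _ * _ in h1 h2.
by move: (\sum_(_ <= _ < _) _) IH => S IH; lra.
Qed.

(** * The iterates of one epoch *)

Section Epoch.
Context {R : realType} {n : nat}.
Variables (x y d u g : nat -> 'rV[R]_n) (lam Lam : nat -> R) (rho sigma : R).
Hypotheses (rho_itv : 0 < rho < 1 / 2) (sigma_itv : 0 < sigma < 1).
Hypotheses (Lam0 : Lam 0%N = 0) (LamS : forall k, Lam k.+1 = Lam k + lam k).
Hypothesis lam_gt0 : forall k, 0 < lam k.

Let a k : R := (1 - 2 * rho) * Lam k.
Let tau k : R := lam k / (a k + lam k).

Hypothesis y_step : forall k,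
  y k.+1 = tau k *: u k + (1 - tau k) *: y k - lam k *: (d k.+1 + g k).
Hypothesis x_proj : forall k,
  dot (tau k *: u k + (1 - tau k) *: (y k - lam k *: d k) - x k.+1)
      (y k.+1 - x k.+1) <= 0.
Hypothesis line_search : forall k,
  lam k * enorm (g k) <= sigma * enorm (x k.+1 - y k.+1).
Hypothesis u_step : forall k, u k.+1 = u k - (rho * lam k) *: d k.+1.
Hypothesis d_mono : forall k,
  0 <= dot (d k.+2 - d k.+1) (y k.+2 - y k.+1).

Let theta_gt0 : 0 < 1 - 2 * rho. Proof. by case/andP: rho_itv; lra. Qed.

Lemma Lam_ge0 k : 0 <= Lam k.
Proof. by elim: k => [|k IH]; rewrite ?Lam0// LamS addr_ge0// ltW. Qed.

Lemma LamS_gt0 k : 0 < Lam k.+1.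
Proof. by rewrite LamS ltr_wpDl// Lam_ge0. Qed.

Let a_ge0 k : 0 <= a k.
Proof. by rewrite mulr_ge0 ?Lam_ge0// ltW. Qed.

Let aS k : a k.+1 = a k + (1 - 2 * rho) * lam k.
Proof. by rewrite /a LamS mulrDr. Qed.

Let a0 : a 0%N = 0. Proof. by rewrite /a Lam0 mulr0. Qed.

(** Induction over [energy_step]: it starts because the anchored weight [a 0]
    vanishes, which also replaces the monotonicity hypothesis at the first
    step, where nothing is known about [d 0]. *)
Lemma energy_ge0 k :
  a k.+1 / 2 * dot (d k.+1) (d k.+1) <= dot (d k.+1) (u k.+1 - y k.+1).
Proof.
pose P j := dot (d j) (u j - y j) - a j / 2 * dot (d j) (d j).
rewrite -subr_ge0 -/(P k.+1).
have step j : 0 <= a j * P j -> 0 <= P j.+1.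
  move=> h; have al : 0 < a j + lam j by rewrite ltr_wpDl.
  rewrite -(pmulr_rge0 _ al); apply: (le_trans h).
  rewrite /P u_step aS; apply: (energy_step sigma_itv rho (a_ge0 j) (lam_gt0 j)
    (y_step j) (x_proj j) (line_search j)).
  case: j {h al} => [|j]; first by rewrite a0 mul0r.
  exact: mulr_ge0.
elim: k => [|k IH]; apply: step; first by rewrite a0 mul0r.
exact: mulr_ge0.
Qed.

(** Completing the square in [energy_ge0]; this is what lets the decay of the
    gap [u k - y k] control [a k *: d k]. *)
Lemma d_gap k : a k ^+ 2 * dot (d k) (d k) <= 4 * dot (u k - y k) (u k - y k).
Proof.
case: k => [|k]; first by rewrite a0 expr0n mul0r mulr_ge0// dot_ge0.
have := dot_ge0 (a k.+1 *: d k.+1 - 2 *: (u k.+1 - y k.+1)).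
have := ler_wpM2l (a_ge0 k.+1) (energy_ge0 k).
by move: (u k.+1 - y k.+1) => v; rewrite !dotE (dotC v); lra.
Qed.

Section Solution.
Variable z : 'rV[R]_n.
Hypothesis z_sol : forall k, 0 <= dot (d k.+1) (y k.+1 - z).

(** Replacing [y k.+1] by a solution only increases the inner product. *)
Lemma d_le_anchor k :
  a k.+1 / 2 * dot (d k.+1) (d k.+1) <= dot (d k.+1) (u k.+1 - z).
Proof.
by have := z_sol k; have := energy_ge0 k; rewrite !dotDr !dotNr; lra.
Qed.

(** Expand [|u k - z|^2] around [u k.+1] and use [d_le_anchor]. *)
Lemma anchor_step k :
  dot (u k.+1 - z) (u k.+1 - z)
    + rho * lam k * (a k.+1 * dot (d k.+1) (d k.+1)) <=
  dot (u k - z) (u k - z).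
Proof.
have rl : 0 <= rho * lam k by rewrite mulr_ge0// ltW//; case/andP: rho_itv.
have -> : u k - z = (u k.+1 - z) + (rho * lam k) *: d k.+1.
  by rewrite u_step addrAC subrK.
have h := d_le_anchor k; move: (u k.+1 - z) h => v h.
have := ler_wpM2l rl h; have := mulr_ge0 rl (mulr_ge0 rl (dot_ge0 (d k.+1))).
by rewrite !dotE (dotC v); lra.
Qed.

Lemma anchor_decr k : dot (u k.+1 - z) (u k.+1 - z) <= dot (u k - z) (u k - z).
Proof.
apply: le_trans (anchor_step k); rewrite lerDl.
case/andP: rho_itv => rho0 _.
apply: mulr_ge0; first by apply: mulr_ge0; exact: ltW.
by apply: mulr_ge0 => //; exact: dot_ge0.
Qed.

Lemma anchor_le0 k : enorm (u k - z) <= enorm (u 0%N - z).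
Proof.
rewrite ler_enorm; elim: k => [//|k IH].
exact: le_trans (anchor_decr k) IH.
Qed.

Lemma d_le k : enorm (d k.+1) <=
  2 * enorm (u k.+1 - z) / ((1 - 2 * rho) * Lam k.+1).
Proof.
rewrite ler_pdivlMr ?mulr_gt0 ?LamS_gt0// -/(a k.+1).
have h := le_trans (d_le_anchor k) (dot_cauchy _ _).
rewrite -enorm_sqr in h.
have [->|d0] := eqVneq (enorm (d k.+1)) 0.
  by rewrite mul0r mulr_ge0// enorm_ge0.
have d1 : 0 < enorm (d k.+1) by rewrite lt_def d0 enorm_ge0.
by rewrite -(ler_pM2l d1); move: h; rewrite expr2; lra.
Qed.

Variables lo hi : R.
Hypothesis lo_gt0 : 0 < lo.
Hypothesis lam_itv : forall k, lo <= lam k <= hi.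

Lemma Lam_lo k : lo * k%:R <= Lam k.
Proof.
elim: k => [|k IH]; first by rewrite Lam0 mulr0.
by rewrite LamS -natr1 mulrDr mulr1 lerD//; case/andP: (lam_itv k).
Qed.

Lemma Lam_hi k : Lam k <= hi * k%:R.
Proof.
elim: k => [|k IH]; first by rewrite Lam0 mulr0.
by rewrite LamS -natr1 mulrDr mulr1 lerD//; case/andP: (lam_itv k).
Qed.

(** In [gap_step] both error terms are bounded by consecutive differences of
    [|u k - z|^2]: [tau (a + lam)^2] is [lam (a + lam)], comparable to the weight
    of [anchor_step] at [k.+1], and [tau a^2] is at most [hi / lo] times its
    weight at [k].  The index is shifted by one so that this second comparison
    makes sense. *)
Lemma gap_cvg0 : (fun k => dot (u k - y k) (u k - y k)) @ \oo --> (0 : R).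
Proof.
pose U k := dot (u k - z) (u k - z).
pose K := 2 + 4 * err_const sigma.
have hi_gt0 : 0 < hi.
  by apply: lt_le_trans lo_gt0 _; case/andP: (lam_itv 0) => /le_trans; exact.
have K0 : 0 < K by rewrite ltr_wpDr// mulr_ge0// err_const_ge0.
have rho0 : 0 < rho by case/andP: rho_itv.
pose c1 := hi / lo / rho; pose c2 := ((1 - 2 * rho) * rho)^-1.
have c10 : 0 <= c1 by rewrite !divr_ge0// ltW.
have c20 : 0 <= c2 by rewrite invr_ge0 mulr_ge0// ltW.
pose W k := K * (c1 * U k + c2 * U k.+1).
suff : (fun k => dot (u k.+1 - y k.+1) (u k.+1 - y k.+1)) @ \oo --> (0 : R).
  by rewrite -(@cvg_shiftS _ (fun k => dot (u k - y k) (u k - y k))).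
apply: (@harmonic_contraction_cvg0 _ _ W (lo / (2 * hi))).
- by rewrite divr_gt0// mulr_gt0.
- by move=> k; exact: dot_ge0.
- move=> k; apply: mulr_ge0; first exact: ltW.
  by apply: addr_ge0; apply: mulr_ge0 => //; exact: dot_ge0.
- move=> k; rewrite ler_pM2l//; apply: lerD; apply: ler_wpM2l => //;
    exact: anchor_decr.
move=> k; rewrite u_step.
have rho01 : 0 <= rho <= 1 by case/andP: rho_itv; lra.
have al : 0 < a k.+1 + lam k.+1 by rewrite ltr_wpDl.
have G := gap_step sigma_itv (a_ge0 k.+1) (lam_gt0 k.+1)
    (y_step k.+1) (x_proj k.+1) (line_search k.+1) rho01.
rewrite -u_step in G *.
have tl : lo / (2 * hi) / k.+1%:R <= tau k.+1.
  rewrite ler_pdivlMr//.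
  have k1 : 0 < k.+1%:R :> R by rewrite ltr0n.
  have sum_le : a k.+1 + lam k.+1 <= 2 * hi * k.+1%:R.
    have := Lam_hi k.+1; have /andP[_ lamhi] := lam_itv k.+1.
    have k2 : 1 <= k.+1%:R :> R by rewrite ler1n.
    have aL : a k.+1 <= Lam k.+1.
      by rewrite /a -[leRHS]mul1r ler_wpM2r ?Lam_ge0//; lra.
    have : hi * 1 <= hi * k.+1%:R by rewrite ler_pM2l.
    lra.
  have c0 : 0 <= lo / (2 * hi) / k.+1%:R.
    by rewrite ltW// !divr_gt0// mulr_gt0.
  have := ler_wpM2l c0 sum_le.
  have -> : lo / (2 * hi) / k.+1%:R * (2 * hi * k.+1%:R) = lo.
    by field; rewrite !gt_eqF// ltr0n.
  by move=> /le_trans; apply; case/andP: (lam_itv k.+1).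
have tE : tau k.+1 * (a k.+1 + lam k.+1) = lam k.+1 by rewrite divfK// gt_eqF.
have t0 : 0 <= tau k.+1 by rewrite divr_ge0// ltW.
have e1 : tau k.+1 * (a k.+1 ^+ 2 * dot (d k.+1) (d k.+1)) <= c1 * (U k - U k.+1).
  have S : rho * lam k * (a k.+1 * dot (d k.+1) (d k.+1)) <= U k - U k.+1.
    by have := anchor_step k; rewrite -/(U k) -/(U k.+1); lra.
  apply: le_trans (ler_wpM2l c10 S).
  have -> : tau k.+1 * (a k.+1 ^+ 2 * dot (d k.+1) (d k.+1)) =
    tau k.+1 * a k.+1 * (a k.+1 * dot (d k.+1) (d k.+1)) by ring.
  have -> : c1 * (rho * lam k * (a k.+1 * dot (d k.+1) (d k.+1))) =
    hi / lo * lam k * (a k.+1 * dot (d k.+1) (d k.+1)).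
    by rewrite /c1; field; rewrite !gt_eqF.
  apply: ler_wpM2r; first by apply: mulr_ge0 => //; exact: dot_ge0.
  apply: (@le_trans _ _ hi).
    have : tau k.+1 * a k.+1 <= lam k.+1.
      by rewrite -[leRHS]tE; apply: ler_wpM2l => //; rewrite lerDl ltW.
    by move=> /le_trans; apply; case/andP: (lam_itv k.+1).
  rewrite mulrAC ler_pdivlMr// ler_pM2l//.
  by case/andP: (lam_itv k).
have e2 : tau k.+1 * ((a k.+1 + lam k.+1) ^+ 2 * dot (d k.+2) (d k.+2)) <=
    c2 * (U k.+1 - U k.+2).
  have S : rho * lam k.+1 * (a k.+2 * dot (d k.+2) (d k.+2)) <= U k.+1 - U k.+2.
    by have := anchor_step k.+1; rewrite -/(U k.+1) -/(U k.+2); lra.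
  apply: le_trans (ler_wpM2l c20 S).
  have -> : tau k.+1 * ((a k.+1 + lam k.+1) ^+ 2 * dot (d k.+2) (d k.+2)) =
    lam k.+1 * dot (d k.+2) (d k.+2) * (a k.+1 + lam k.+1).
    by rewrite -{2}tE; ring.
  have -> : c2 * (rho * lam k.+1 * (a k.+2 * dot (d k.+2) (d k.+2))) =
    lam k.+1 * dot (d k.+2) (d k.+2) * (a k.+2 / (1 - 2 * rho)).
    by rewrite /c2; field; rewrite !gt_eqF.
  apply: ler_wpM2l; first by apply: mulr_ge0; [exact: ltW|exact: dot_ge0].
  rewrite ler_pdivlMr// (aS k.+1) mulrDl (mulrC (lam _)) lerD2r.
  by rewrite -[leRHS]mulr1; apply: ler_wpM2l => //; lra.
apply: (le_trans (lerD G (lexx _))).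
have := ler_wpM2r (dot_ge0 (u k.+1 - y k.+1)) tl.
have := ler_wpM2l (ltW K0) (lerD e1 e2).
rewrite /W -/K -/(tau k.+1).
set v := dot (_ - _) (_ - _); set p := lo / _ / _ * _.
lra.
Qed.
End Solution.
End Epoch.

(** * Line search and restarts *)

Section Run.
Context {R : realType} {n : nat}.
Variables (domF : set 'rV[R]_n) (F : 'rV[R]_n -> 'rV[R]_n)
  (B : 'rV[R]_n -> set 'rV[R]_n) (L : R)
  (p : maegr_params R n) (x0 : 'rV[R]_n) (s : maegr_trace R n).
Hypotheses (B_max : maximal_monotone_op B)
  (domB_neq0 : op_dom B !=set0) (F_lip : elipschitz_on domF F L)
  (p_valid : valid_params domF B p) (s_run : maegr_run F B p s x0).

Local Notation arrives := (arrives F B p s).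
Local Notation computes := (computes F B p s).
Local Notation terminates_at := (terminates_at F B s).
Local Notation ls_least := (ls_least F B p s).
Local Notation ls_stop := (ls_stop F B p s).
Local Notation restarts_at := (restarts_at F B p s).
Local Notation lam_lo := (lam_lo p s).
Local Notation x_at := (x_at p s).
Local Notation y_at := (y_at F B p s).

Lemma arrivesS r k : arrives r k.+1 ->
  [/\ arrives r k, computes r k & lam_lo r <= tlam s r k.+1].
Proof. by move=> H; inversion H. Qed.

Lemma arrives_le r j k : (j <= k)%N -> arrives r k -> arrives r j.
Proof.
elim: k => [|k IH]; first by rewrite leqn0 => /eqP ->.
by rewrite leq_eqVlt => /orP[/eqP -> //|jk /arrivesS[/(IH jk)]].
Qed.

Lemma arrives_computes r j k : (j < k)%N -> arrives r k -> computes r j.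
Proof. by move=> /arrives_le jk /jk/arrivesS[]. Qed.

Lemma arrives_epoch0 r : arrives r.+1 0 -> r = 0%N \/ exists k, restarts_at r k.
Proof.
move=> H; inversion H as [|r' k' Ha Hc Hl Er|r' k' Ha Hc Hl Er]; first by left.
by right; exists k'.
Qed.

Let beta_gt0 : 0 < pbeta p. Proof. by case: p_valid => _ _ _ [_ /andP[]]. Qed.
Let beta_lt1 : pbeta p < 1. Proof. by case: p_valid => _ _ _ [_ /andP[]]. Qed.
Let sigma_gt0 : 0 < psigma p. Proof. by case: p_valid => _ _ _ [_ _ /andP[]]. Qed.

Lemma computes_step r k : arrives r k -> computes r k ->
  exists2 j, ls_least r k j & tlam s r k.+1 = ls_step p s r k j.
Proof.
move=> ark [nt [j lj]]; exists j => //.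
by case: s_run => _ /(_ _ _ ark nt)[_ /(_ _ lj)[]].
Qed.

Lemma ls_start_gt0 r k : arrives r k -> ~ terminates_at r k ->
  0 < ls_start p s r k.
Proof.
have first r' : arrives r' 0 -> ~ terminates_at r' 0 -> 0 < talpha s r' 1.
  by move=> ar nt; case: s_run => _ /(_ _ _ ar nt)[[]].
move=> ark nt; rewrite /ls_start; case: k ark nt => [|k] ark nt; first exact: first.
have [[al_gt0 _] _] : admissible_alpha p s r k.+1 /\ maeg_step F B p s r k.+1.
  by case: s_run => _ /(_ _ _ ark nt).
rewrite lt_min al_gt0 mulr_gt0//=.
  by case: p_valid => _ _ _ _ [_]; apply: lt_trans.
have ar0 := arrives_le (leq0n _) ark.
have c0 := arrives_computes (ltn0Sn _) ark.
have [j _ ->] := computes_step ar0 c0.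
by rewrite mulr_gt0 ?exprn_gt0//; apply: first => //; case: c0.
Qed.

Lemma tlam_gt0 r k : arrives r k -> computes r k -> 0 < tlam s r k.+1.
Proof.
move=> ark c; have [j _ ->] := computes_step ark c.
by rewrite mulr_gt0 ?exprn_gt0//; apply: ls_start_gt0 => //; case: c.
Qed.

Lemma x_at_projP r k l : let t := tau_at p s r k l in
  pX p (x_at r k l) /\ forall q, pX p q ->
    dot (t *: tu s r k + (1 - t) *: (ty s r k - l *: td s r k) - x_at r k l)
        (q - x_at r k l) <= 0.
Proof. by case: p_valid => -[X0 Xcl Xcv _ _] *; exact: eprojP. Qed.

Lemma y_atP r k l : 0 < l -> let t := tau_at p s r k l in
  exists2 b, B (y_at r k l) b &
    y_at r k l + l *: b =
      t *: tu s r k + (1 - t) *: ty s r k - l *: F (x_at r k l).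
Proof. by move=> l0; exact: resolventP. Qed.

Lemma domB_X y b : B y b -> pX p y.
Proof.
case: p_valid => -[_ _ _ BX _] _ _ _ _ Byb.
by apply/BX/subset_closure; exists b.
Qed.

Lemma X_domF y : pX p y -> domF y.
Proof. by case: p_valid => -[_ _ _ _ XF] _ _ _ _; exact: XF. Qed.

(** A positive Lipschitz constant; [L] itself may be nonpositive. *)
Let L1 := Num.max L 1.
Let L1_gt0 : 0 < L1. Proof. by rewrite lt_max ltr01 orbT. Qed.

Lemma ls_stop_small r k j : 0 < ls_start p s r k ->
  ls_step p s r k j <= psigma p / L1 -> ls_stop r k j.
Proof.
move=> st0 lle; rewrite /ls_stop; set l := ls_step _ _ _ _ _ in lle *.
have l0 : 0 < l by rewrite mulr_gt0// exprn_gt0.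
right; have [xX _] := x_at_projP r k l; have [b By _] := y_atP r k l0.
apply: (le_trans (ler_wpM2l (ltW l0) (F_lip (X_domF xX) (X_domF (domB_X By))))).
rewrite mulrA; apply: ler_wpM2r; first exact: enorm_ge0.
apply: (@le_trans _ _ (l * L1)); first by rewrite ler_pM2l// le_max lexx.
by rewrite -ler_pdivlMr.
Qed.

Lemma ls_terminates r k : arrives r k -> ~ terminates_at r k -> computes r k.
Proof.
move=> ark nt; split => //.
have st0 := ls_start_gt0 ark nt.
have [N _ /(_ N (leqnn N)) HN] : \forall j \near \oo,
    pbeta p ^+ j <= psigma p / L1 / ls_start p s r k.
  have : (fun j => pbeta p ^+ j) @ \oo --> (0 : R).
    by apply: cvg_expr; rewrite ger0_norm// ltW.
  by move/cvgr_le; apply; rewrite !divr_gt0.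
have exj : exists j, `[< ls_stop r k j >].
  exists N; apply/asboolP; apply: ls_stop_small => //.
  by rewrite /ls_step mulrC -ler_pdivlMr.
case: (ex_minnP exj) => j /asboolP stj minj; exists j; split => // i ij sti.
by move: (minj i); rewrite leqNgt ij => H; have := H (asboolT sti).
Qed.

Lemma lam_lo_le r : lam_lo r <= pm p * tlam s r 1 /\ lam_lo r <= peps p r.
Proof. by split; rewrite /lam_lo ge_min lexx ?orbT. Qed.

(** A restart cannot happen at the first iteration since [m < 1].  Later, a
    stepsize accepted without backtracking is at least the lower bound of its
    epoch; otherwise the previous trial stepsize was refused while above that
    bound, so it violated the smallness condition of [ls_stop_small]. *)
Lemma restart_eps r k : restarts_at r k -> psigma p * pbeta p / L1 < peps p r.
Proof.
move=> [ark c lt_lo].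
have m_gt0 : 0 < pm p by case: p_valid => _ _ _ [_ _ _ /andP[]].
have m_lt1 : pm p < 1 by case: p_valid => _ _ _ [_ _ _ /andP[]].
have [lo1 lo2] := lam_lo_le r.
apply: le_lt_trans (lt_le_trans lt_lo lo2).
have lam_gt0 := tlam_gt0 ark c.
case: k ark c lt_lo lam_gt0 => [|k] ark c lt_lo lam_gt0.
  have : tlam s r 1 < pm p * tlam s r 1 by exact: lt_le_trans lo1.
  by rewrite -[ltLHS]mul1r ltr_pM2r// ltNge ltW.
have [_ _ lam_ge] := arrivesS ark.
have [j [stj minj] lamE] := computes_step ark c.
have nt : ~ terminates_at r k.+1 by case: c.
have st0 := ls_start_gt0 ark nt.
case: j stj minj lamE => [|j] stj minj lamE.
  suff : lam_lo r <= tlam s r k.+2 by rewrite leNgt lt_lo.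
  rewrite lamE /ls_step expr0 mulr1 /ls_start/= le_min; apply/andP; split.
    apply: (le_trans lam_ge).
    by case: s_run => _ /(_ _ _ ark nt)[[]].
  apply: (le_trans lo1); rewrite /lam_hi ler_wpM2r//; last first.
    by apply: le_trans (ltW m_lt1) _; case: p_valid => _ _ _ _ [_ /ltW].
  have ar0 := arrives_le (leq0n _) ark.
  exact: ltW (tlam_gt0 ar0 (arrives_computes (ltn0Sn _) ark)).
have : psigma p / L1 < ls_step p s r k.+1 j.
  by rewrite ltNge; apply/negP => /(ls_stop_small st0); exact: minj.
rewrite lamE /ls_step exprSr mulrA => h.
by rewrite mulrAC ler_pM2r// ltW.
Qed.

Lemma restart_bounded : exists N, forall r k, restarts_at r k -> (r < N)%N.
Proof.
have [_ eps0] : (forall r, (1 <= r)%N -> 0 < peps p r) /\ peps p @ \oo --> (0 : R).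
  by case: p_valid.
have [N _ HN] : \forall r \near \oo, peps p r <= psigma p * pbeta p / L1.
  by move/cvgr_le: eps0; apply; rewrite divr_gt0// mulr_gt0.
exists N => r k /restart_eps; rewrite ltNge => /negP h.
by rewrite ltnNge; apply/negP => /HN.
Qed.

Lemma restarts_at_uniq r j k : restarts_at r j -> restarts_at r k -> j = k.
Proof.
wlog jk : j k / (j <= k)%N.
  by move=> h; case/orP: (leq_total j k) => [/h//|/h h' ? ?]; apply/esym/h'.
move=> [arj cj ltj] [ark ck ltk]; apply/eqP; rewrite eqn_leq jk leqNgt.
by apply/negP => /arrives_le/(_ ark)/arrivesS[_ _]; rewrite leNgt ltj.
Qed.

(** Each epoch has at most one restart, so restarts are indexed by epochs. *)
Lemma finitely_many_restarts :
  finite_set [set rk : nat * nat | restarts_at rk.1 rk.2].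
Proof.
have [N HN] := restart_bounded.
pose k_ r := xget 0%N [set k | restarts_at r k].
apply: (@sub_finite_set _ _ ((fun r => (r, k_ r)) @` `I_N)); last first.
  exact/finite_image/finite_II.
move=> [r k] /= rk; exists r; first exact: HN rk.
by congr (_, _); rewrite /k_; case: xgetP => [j _ rj|/(_ k)//]; exact: restarts_at_uniq rk.
Qed.

(** Epochs are bounded by [restart_bounded]; in the largest one every iterate is
    accepted, as a rejection would open a further epoch. *)
Lemma last_epoch_exists : never_terminates F B p s ->
  exists r, last_epoch F B p s r /\ forall k, arrives r k.
Proof.
move=> nt; have [N HN] := restart_bounded.
have bnd r : `[< arrives r 0 >] -> (r <= N.+1)%N.
  move=> /asboolP; case: r => // r /arrives_epoch0[->//|[k /HN]].
  by move=> /ltnW; rewrite ltnS.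
have ex0 : exists r, `[< arrives r 0 >] by exists 1%N; apply/asboolP; constructor.
case: (ex_maxnP ex0 bnd) => r /asboolP ar0 maxr; exists r.
have lastr r' k : arrives r' k -> (r' <= r)%N.
  by move=> /(arrives_le (leq0n _)) h; apply/maxr/asboolP.
split=> [//|]; elim=> [//|k ark].
have c := ls_terminates ark (nt _ _ ark).
apply: arrives_next => //; rewrite leNgt; apply/negP => lt_lo.
by have /lastr := arrives_restart ark c lt_lo; rewrite ltnn.
Qed.
End Run.

(** * The last epoch of a run *)

Section LastEpoch.
Context {R : realType} {n : nat}.
Variables (domF : set 'rV[R]_n) (F : 'rV[R]_n -> 'rV[R]_n)
  (B : 'rV[R]_n -> set 'rV[R]_n)
  (p : maegr_params R n) (x0 : 'rV[R]_n) (s : maegr_trace R n).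
Hypotheses (F_mono : monotone_on domF F) (B_max : maximal_monotone_op B)
  (domB_neq0 : op_dom B !=set0)
  (p_valid : valid_params domF B p) (s_run : maegr_run F B p s x0).
Variable r : nat.
Hypothesis arr : forall k, arrives F B p s r k.

Let comp k : computes F B p s r k.
Proof. exact: arrives_computes (ltnSn k) (arr k.+1). Qed.

Lemma epoch_starts : exists z, starts_epoch s r z.
Proof.
have := arr 0; case: r => [H|r' H]; first by inversion H.
case: s_run => st _ rst.
have [->|[k /rst]] := arrives_epoch0 H; first by exists x0.
by exists (restart_point B p s r' k).
Qed.

Let lam k : R := tlam s r k.+1.
Let g k := F (tx s r k.+1) - F (ty s r k.+1).

Lemma epoch_lam_gt0 k : 0 < lam k.
Proof. exact: (tlam_gt0 p_valid s_run). Qed.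

Lemma epoch_step k : let t := tau_at p s r k (lam k) in
  [/\ tx s r k.+1 = x_at p s r k (lam k) /\ ty s r k.+1 = y_at F B p s r k (lam k),
      tLam s r k.+1 = tLam s r k + lam k,
      ty s r k.+1 = t *: tu s r k + (1 - t) *: ty s r k
                    - lam k *: (td s r k.+1 + g k) &
      tu s r k.+1 = tu s r k - (prho p * lam k) *: td s r k.+1].
Proof.
case: (comp k) => nt [j lj].
have [_ run _] := s_run; have [_ /(_ _ lj)] := run _ _ (arr k) nt.
rewrite /= -/(lam k) => -[_ xyE LE dE uE]; split => //.
apply/rowP => i; have /rowP/(_ i) := dE; rewrite /g !mxE => ->.
by field; rewrite gt_eqF// epoch_lam_gt0.
Qed.

(** The definition of [d] cancels [F (x)] against the one in the resolvent
    step, leaving an element of [(F + B) (y)]. *)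
Lemma epoch_graph k : exists2 b, B (ty s r k.+1) b & td s r k.+1 = F (ty s r k.+1) + b.
Proof.
have [[xE yE] _ y_step _] := epoch_step k.
have [b Bb ybE] := y_atP F p s B_max domB_neq0 r k (epoch_lam_gt0 k).
rewrite -yE -xE in Bb ybE; exists b => //.
have l0 : lam k != 0 by rewrite gt_eqF// epoch_lam_gt0.
apply/rowP => i; apply: (mulfI l0).
have /rowP/(_ i) := ybE; have /rowP/(_ i) := y_step.
by rewrite /g !mxE; lra.
Qed.

Lemma epoch_x_proj k : let t := tau_at p s r k (lam k) in
  dot (t *: tu s r k + (1 - t) *: (ty s r k - lam k *: td s r k) - tx s r k.+1)
    (ty s r k.+1 - tx s r k.+1) <= 0.
Proof.
have [[xE _] _ _ _] := epoch_step k; have [b Bb _] := epoch_graph k.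
have [_ xp] := x_at_projP s p_valid r k (lam k).
by rewrite xE; apply: xp; exact: (domB_X p_valid) Bb.
Qed.

Lemma epoch_lam_lo k : lam_lo p s r <= lam k.
Proof. by have [_ _] := arrivesS (arr k.+1). Qed.

Lemma epoch_lam_lo_gt0 : 0 < lam_lo p s r.
Proof.
have [_ [eps_gt0 _] _ [_ _ _ /andP[m_gt0 _]] _] := p_valid.
rewrite lt_min mulr_gt0//=; last exact: epoch_lam_gt0 0%N.
apply: eps_gt0; have := arr 0; case: (r) => [H|//]; by inversion H.
Qed.

Lemma epoch_lam_hi k : lam k <= lam_hi p s r.
Proof.
have [_ _ _ [_ /andP[b0 b1] _ _] [_ /ltW M1]] := p_valid.
case: k => [|k].
  by rewrite /lam_hi -[leLHS]mul1r ler_wpM2r// ltW//; exact: epoch_lam_gt0 0%N.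
have [j _ lamE] := computes_step s_run (arr k.+1) (comp k.+1).
have st0 : 0 < ls_start p s r k.+1.
  by apply: (ls_start_gt0 p_valid s_run (arr _)); case: (comp k.+1).
rewrite /lam lamE /ls_step; apply: (@le_trans _ _ (ls_start p s r k.+1)).
  by rewrite ler_piMr ?exprn_ile1// ltW.
by rewrite /ls_start/= ge_min lexx orbT.
Qed.

Lemma epoch_line_search k :
  lam k * enorm (g k) <= psigma p * enorm (tx s r k.+1 - ty s r k.+1).
Proof.
have [[xE yE] _ _ _] := epoch_step k.
have [j [[]]] := computes_step s_run (arr k) (comp k); last first.
  by move=> + _ lamE; rewrite -lamE /g xE yE.
move=> + _ lamE; rewrite -lamE /ls_lo ltNge => /negP[].
by case: k {xE yE lamE} => [|k] /=; [exact/ltW/epoch_lam_gt0|exact: epoch_lam_lo].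
Qed.

Lemma epoch_dom k : domF (ty s r k.+1).
Proof.
by have [b /(domB_X p_valid)/(X_domF p_valid)] := epoch_graph k.
Qed.

Lemma epoch_mono j k :
  0 <= dot (td s r j.+1 - td s r k.+1) (ty s r j.+1 - ty s r k.+1).
Proof.
have [b Bb ->] := epoch_graph j; have [c Bc ->] := epoch_graph k.
rewrite opprD addrACA dotDl addr_ge0//.
  exact: F_mono (epoch_dom j) (epoch_dom k).
exact: B_max.1 Bb Bc.
Qed.

Lemma epoch_sol z : Sol F B z -> forall k, 0 <= dot (td s r k.+1) (ty s r k.+1 - z).
Proof.
move=> [b Bb zb] k; have [c Bc ->] := epoch_graph k.
have -> : F (ty s r k.+1) + c = (F (ty s r k.+1) - F z) + (c - b).
  by rewrite addrACA -opprD zb subr0.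
rewrite dotDl addr_ge0//; last exact: B_max.1 Bc Bb.
by apply: F_mono; [exact: epoch_dom|exact/(X_domF p_valid)/(domB_X p_valid)/Bb].
Qed.

Lemma epoch_natres k : enorm (natres F B (ty s r k.+1)) <= enorm (td s r k.+1).
Proof. by have [b Bb ->] := epoch_graph k; exact: natres_le. Qed.

End LastEpoch.

(** * Convergence rates *)

Lemma bigO_inv_nat {R : realType} (f : nat -> R) (K : R) :
    (forall k, (0 < k)%N -> 0 <= f k /\ f k <= K / k%:R) ->
  f =O_\oo (fun k => k%:R^-1 : R).
Proof.
move=> fK; apply/eqO_exP; exists (`|K| + 1); first by rewrite ltr_pwDr.
near=> k; have k0 : (0 < k)%N by near: k; exact: nbhs_infty_gt.
have [f0 fk] := fK k k0.
have ki : 0 < k%:R^-1 :> R by rewrite invr_gt0 ltr0n.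
rewrite (ger0_norm f0) (ger0_norm (ltW ki)); apply: (le_trans fk).
by rewrite ler_pM2r// (le_trans (ler_norm K))// lerDl.
Unshelve. all: by end_near. Qed.

Lemma littleo_inv_nat {R : realType} (f e : nat -> R) (c : R) : 0 < c ->
    (forall k, (0 < k)%N -> 0 <= f k /\ (c * k%:R * f k) ^+ 2 <= e k) ->
    e @ \oo --> (0 : R) ->
  f =o_\oo (fun k => k%:R^-1 : R).
Proof.
move=> c0 fe e0; apply/eqoP => eps eps0.
have ce : 0 < c * eps by rewrite mulr_gt0.
have e_small : \forall k \near \oo, e k <= (c * eps) ^+ 2.
  by move/cvgr_le: e0; apply; rewrite exprn_gt0.
near=> k; have k0 : (0 < k)%N by near: k; exact: nbhs_infty_gt.
have [f0 fk] := fe k k0.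
have kR : 0 < k%:R :> R by rewrite ltr0n.
rewrite (ger0_norm f0) ger0_norm ?invr_ge0 ?(ltW kR)// ler_pdivlMr//.
have ek : e k <= (c * eps) ^+ 2 by near: k.
have ckf : 0 <= c * k%:R * f k.
  by apply: mulr_ge0 => //; rewrite ltW// mulr_gt0.
have : c * k%:R * f k <= c * eps.
  by rewrite -ler_sqr ?nnegrE ?(ltW ce)//; exact: le_trans ek.
by rewrite -mulrA ler_pM2l// mulrC.
Unshelve. all: by end_near. Qed.

Theorem mainTheorem6 (R : realType) (n : nat)
    (domF : set 'rV[R]_n) (F : 'rV[R]_n -> 'rV[R]_n)
    (B : 'rV[R]_n -> set 'rV[R]_n) (L : R)
    (p : maegr_params R n) (x0 : 'rV[R]_n) (s : maegr_trace R n)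
    (F_mono : monotone_on domF F)
    (F_cont : {within domF, continuous F})
    (B_max : maximal_monotone_op B)
    (domBF : closure (op_dom B) `<=` domF)
    (Sol_neq0 : Sol F B !=set0)
    (F_lip : elipschitz_on domF F L)
    (p_valid : valid_params domF B p)
    (x0_dom : closure (op_dom B) x0)
    (s_run : maegr_run F B p s x0) :
  finite_set [set rk : nat * nat | restarts_at F B p s rk.1 rk.2] /\
  (never_terminates F B p s ->
   exists r : nat,
   [/\ last_epoch F B p s r,
       forall k : nat, arrives F B p s r k,
       forall (xstar : 'rV[R]_n) (k : nat), Sol F B xstar -> (1 <= k)%N ->
         [/\ enorm (natres F B (ty s r k)) <= enorm (td s r k),
             enorm (td s r k) <=
               2 * enorm (tu s r k - xstar) / ((1 - 2 * prho p) * tLam s r k) &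
             2 * enorm (tu s r k - xstar) / ((1 - 2 * prho p) * tLam s r k) <=
               2 * enorm (tu s r 0 - xstar) / ((1 - 2 * prho p) * tLam s r k)],
       (fun k : nat => enorm (td s r k)) =O_\oo (fun k : nat => (k%:R^-1 : R)) /\
       (fun k : nat => enorm (natres F B (ty s r k)))
         =O_\oo (fun k : nat => (k%:R^-1 : R)) &
       (fun k : nat => enorm (td s r k)) =o_\oo (fun k : nat => (k%:R^-1 : R)) /\
       (fun k : nat => enorm (natres F B (ty s r k)))
         =o_\oo (fun k : nat => (k%:R^-1 : R))]).
Proof.
have domB_neq0 : op_dom B !=set0 by case: Sol_neq0 => z [b Bb _]; exists z, b.
split; first exact: finitely_many_restarts B_max domB_neq0 F_lip p_valid s_run.
move=> nt.
have [r [last_r arr]] :=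
  last_epoch_exists B_max domB_neq0 F_lip p_valid s_run nt.
exists r.
have [_ _ _ [rho_itv _ sigma_itv _] _] := p_valid.
have [z0 [_ _ _ _ Lam0]] := epoch_starts s_run arr.
have step k := epoch_step p_valid s_run arr k.
have LamS k : tLam s r k.+1 = tLam s r k + tlam s r k.+1 by case: (step k).
have lam_gt0 := epoch_lam_gt0 p_valid s_run arr.
have y_step k := let: And4 _ _ h _ := step k in h.
have u_step k := let: And4 _ _ _ h := step k in h.
have x_proj := epoch_x_proj B_max domB_neq0 p_valid s_run arr.
have line_search := epoch_line_search p_valid s_run arr.
have d_mono k := epoch_mono F_mono B_max domB_neq0 p_valid s_run arr k.+1 k.
have z_sol z (zS : Sol F B z) :=
  epoch_sol F_mono B_max domB_neq0 p_valid s_run arr zS.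
have natres_d := epoch_natres B_max domB_neq0 p_valid s_run arr.
have lo_gt0 := epoch_lam_lo_gt0 p_valid s_run arr.
have lam_itv k : lam_lo p s r <= tlam s r k.+1 <= lam_hi p s r.
  by rewrite (epoch_lam_lo arr k) (epoch_lam_hi p_valid s_run arr k).
have theta_gt0 : 0 < 1 - 2 * prho p by case/andP: rho_itv; lra.
have Lam_gt0 k : 0 < (1 - 2 * prho p) * tLam s r k.+1.
  by rewrite mulr_gt0//; exact: (LamS_gt0 Lam0 LamS lam_gt0 k).
have Lam_ge k : (1 - 2 * prho p) * (lam_lo p s r * k%:R) <=
    (1 - 2 * prho p) * tLam s r k.
  by rewrite ler_pM2l//; exact: (Lam_lo Lam0 LamS lam_itv k).
have d_bound z (zS : Sol F B z) := d_le rho_itv sigma_itv Lam0 LamS lam_gt0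
  y_step x_proj line_search u_step d_mono (z_sol z zS).
have u_bound z (zS : Sol F B z) := anchor_le0 rho_itv sigma_itv Lam0 LamS lam_gt0
  y_step x_proj line_search u_step d_mono (z_sol z zS).
have rate z k (zS : Sol F B z) :
    2 * enorm (tu s r k.+1 - z) / ((1 - 2 * prho p) * tLam s r k.+1) <=
    2 * enorm (tu s r 0 - z) / ((1 - 2 * prho p) * tLam s r k.+1).
  by rewrite ler_pM2r ?invr_gt0// ler_pM2l//; exact: u_bound.
have [z zS] := Sol_neq0.
pose c := (1 - 2 * prho p) * lam_lo p s r.
have c_gt0 : 0 < c by exact: mulr_gt0.
have dO k : (0 < k)%N -> enorm (td s r k) <= 2 * enorm (tu s r 0 - z) / c / k%:R.
  case: k => // k _; apply: (le_trans (d_bound z zS k)); apply: (le_trans (rate z k zS)).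
  rewrite -[leRHS]mulrA -invfM ler_wpM2l// ?mulr_ge0 ?enorm_ge0//.
  by rewrite lef_pV2 ?posrE// ?mulr_gt0 ?ltr0n// /c -mulrA.
have gap := gap_cvg0 rho_itv sigma_itv Lam0 LamS lam_gt0
  y_step x_proj line_search u_step d_mono (z_sol z zS) lo_gt0 lam_itv.
have dgap := d_gap rho_itv sigma_itv Lam0 LamS lam_gt0
  y_step x_proj line_search u_step d_mono.
have do_ k : (c * k%:R * enorm (td s r k)) ^+ 2 <=
    4 * dot (tu s r k - ty s r k) (tu s r k - ty s r k).
  apply: le_trans (dgap k); rewrite exprMn enorm_sqr ler_wpM2r ?dot_ge0//.
  rewrite lerXn2r ?nnegrE ?mulr_ge0 ?ler0n ?(ltW c_gt0) ?(ltW theta_gt0) ?(ltW lo_gt0)//.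
    exact: Lam_ge0 Lam0 LamS lam_gt0 k.
  by rewrite /c -mulrA.
have gap4 : (fun k => 4 * dot (tu s r k - ty s r k) (tu s r k - ty s r k))
    @ \oo --> (0 : R).
  by rewrite -(mulr0 4); apply: cvgM gap; exact: cvg_cst.
have nr k : (0 < k)%N -> enorm (natres F B (ty s r k)) <= enorm (td s r k).
  by case: k => // k _; exact: natres_d.
split=> //.
- move=> xs [//|k] xsS _; split; [exact: natres_d|exact: d_bound|exact: rate].
- split; apply: bigO_inv_nat => k k0.
    by rewrite enorm_ge0; split => //; exact: dO.
  by rewrite enorm_ge0; split => //; exact: le_trans (nr k k0) (dO k k0).
- split; apply: (littleo_inv_nat c_gt0 _ gap4) => k k0; rewrite enorm_ge0; split=> //.
  apply: le_trans (do_ k).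
  have ck : 0 <= c * k%:R by rewrite mulr_ge0// ltW.
  rewrite ler_sqr ?nnegrE; try exact: mulr_ge0 ck (enorm_ge0 _).
  by apply: ler_wpM2l => //; exact: nr.
Qed.
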